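(* For all integers $m,n\ge 2$, the complete bipartite graph $K_{m,n}$ satisfies $Z_g(K_{m,n})=m+n-2$.
   Context: All graphs are finite and simple. The game: Let $G$ be a connected graph with at least one edge; initially all vertices are white. Alice (blue) and Bob (red) alternate turns, Alice first. On each turn the player makes exactly one move: a seed move (colour one white vertex with the player's colour) or a force move $u\to v$ (if a vertex $u$ of the player's colour has exactly one white neighbour $v$, colour $v$ with the player's colour). Being the unique white neighbour is with respect to all white vertices, irrespective of who coloured the others. If a white vertex is the target of one of the player's own legal forces, colouring it counts as a force move and not as a seed move. A move blocks a legal force $u\to v$ if that force is no longer legal after the move. Force Preservation Rule: considering the opponent's legal forces (those the opponent's coloured vertices could make) at the beginning of a turn, (i) a player may always perform one of their own legal forces, even if this blocks a force of the opponent; (ii) a seed move that blocks a legal force of the opponent is permitted only when every available seed move blocks at least one of the opponent's legal forces. The game ends when every vertex is coloured. Optimal play and $Z_g$: For a position $P$ define a set $\mathcal O(P)$ of pairs. If $P$ is terminal and Alice and Bob made $s_A$ and $s_B$ seed moves in total, then $\mathcal O(P)=\{(s_A,s_B)\}$. Otherwise let $\mathcal U(P)=\bigcup_m \mathcal O(P_m)$ over all legal moves $m$, where $P_m$ is the resulting position; $\mathcal O(P)$ is the set of all pairs in $\mathcal U(P)$ with minimum first coordinate if Alice is to move, and with minimum second coordinate if Bob is to move. Let $\mathcal O(G)=\mathcal O(P_0(G))$ for the initial position $P_0(G)$. The game zero forcing number is $Z_g(G)=\min\{s_A+s_B:(s_A,s_B)\in\mathcal O(G)\}$. *)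

(* Defs.v *)
From mathcomp Require Import all_boot.

Set Implicit Arguments.
Unset Strict Implicit.
Unset Printing Implicit Defensive.

Record sgraph := SGraph {
  vertex :> finType;
  edge : rel vertex;
  edge_sym : symmetric edge;
  edge_irr : irreflexive edge
}.

Definition bip_edge (m n : nat) : rel ('I_m + 'I_n)%type := fun x y =>
  match x, y with
  | inl _, inr _ | inr _, inl _ => true
  | _, _ => false
  end.

Lemma bip_edge_sym m n : symmetric (@bip_edge m n).
Proof. by case=> ? []. Qed.

Lemma bip_edge_irr m n : irreflexive (@bip_edge m n).
Proof. by case. Qed.

Definition complete_bipartite (m n : nat) : sgraph :=
  SGraph (@bip_edge_sym m n) (@bip_edge_irr m n).

Definition player := bool.
Definition Alice : player := true.
Definition Bob : player := false.
Definition opponent (p : player) : player := ~~ p.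

Section Game.
Variable G : sgraph.

(* [None] is white, [Some Alice] is blue and [Some Bob] is red. *)
Definition colouring := {ffun G -> option player}.

Definition white (c : colouring) : {set G} := [set v | c v == None].

Definition paint (c : colouring) (p : player) (v : G) : colouring :=
  [ffun w => if w == v then Some p else c w].

Definition legal_force (c : colouring) (p : player) (u v : G) : bool :=
  (c u == Some p) && ([set w in white c | edge u w] == [set v]).

(* A white vertex that the player can force is not available as a seed. *)
Definition available_seed (c : colouring) (p : player) (v : G) : bool :=
  (v \in white c) && ~~ [exists u, legal_force c p u v].

Definition blocks (c : colouring) (p : player) (v : G) : bool :=
  [exists u, exists w, legal_force c (opponent p) u w
                       && ~~ legal_force (paint c p v) (opponent p) u w].

Definition legal_seed (c : colouring) (p : player) (v : G) : bool :=
  available_seed c p v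
  && (blocks c p v ==> [forall w, available_seed c p w ==> blocks c p w]).

Definition move := (G + G * G)%type.
Definition Seed (v : G) : move := inl v.
Definition Force (u v : G) : move := inr (u, v).

(* [score] is the pair of numbers of seed moves made so far by Alice, Bob. *)
Record position := Position {
  colours : colouring;
  to_move : player;
  score : nat * nat
}.

Definition initial : position := Position [ffun => None] Alice (0, 0).

Definition add_seed (p : player) (s : nat * nat) : nat * nat :=
  if p == Alice then (s.1.+1, s.2) else (s.1, s.2.+1).

Definition play (P : position) (mv : move) : position :=
  let: Position c p s := P in
  match mv with
  | inl v => Position (paint c p v) (opponent p) (add_seed p s)
  | inr (_, v) => Position (paint c p v) (opponent p) s
  end.

Definition legal_moves (P : position) : seq move :=
  let: Position c p _ := P in
  [seq Seed v | v <- enum G & legal_seed c p v]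
  ++ [seq Force uv.1 uv.2 | uv <- enum {: G * G} & legal_force c p uv.1 uv.2].

Definition terminal (P : position) : bool := white (colours P) == set0.

Definition own_seeds (p : player) (s : nat * nat) : nat :=
  if p == Alice then s.1 else s.2.

Definition optimal (p : player) (U : seq (nat * nat)) : seq (nat * nat) :=
  [seq s <- U | all (fun t => own_seeds p s <= own_seeds p t) U].

(* Every move colours exactly one vertex, so a position with [k] white vertices
   is exactly [k] moves away from the end of the game: see [outcomesE]. *)
Fixpoint outcomes_rec (k : nat) (P : position) : seq (nat * nat) :=
  if k is k'.+1 then
    optimal (to_move P)
      (flatten [seq outcomes_rec k' (play P mv) | mv <- legal_moves P])
  else [:: score P].

Definition outcomes (P : position) : seq (nat * nat) :=
  outcomes_rec #|white (colours P)| P.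

Lemma legal_force_white c p u v : legal_force c p u v -> v \in white c.
Proof.
case/andP=> _ /eqP E; have: v \in [set v] by rewrite set11.
by rewrite -E inE => /andP[].
Qed.

Lemma white_paint c p v : white (paint c p v) = white c :\ v.
Proof. by apply/setP=> w; rewrite !inE ffunE; case: (w == v). Qed.

Lemma card_white_play P mv :
  mv \in legal_moves P ->
  #|white (colours P)| = #|white (colours (play P mv))|.+1.
Proof.
have card_paint c p v : v \in white c -> #|white c| = #|white (paint c p v)|.+1.
  by move=> vW; rewrite white_paint (cardsD1 v) vW.
case: P => c p s; rewrite /= mem_cat => /orP[] /mapP[x].
  by rewrite mem_filter => /andP[/andP[/andP[xW _] _] _] ->; exact: card_paint.
by rewrite mem_filter => /andP[/legal_force_white xW _] ->; exact: card_paint.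
Qed.

Lemma outcomesE P :
  outcomes P =
    if terminal P then [:: score P] else
    optimal (to_move P)
      (flatten [seq outcomes (play P mv) | mv <- legal_moves P]).
Proof.
rewrite {1}/outcomes /terminal -cards_eq0.
case E: #|white (colours P)| => [|k] //=; congr (optimal _ (flatten _)).
apply/eq_in_map => mv /card_white_play; rewrite E => -[Ek].
by rewrite /outcomes -Ek.
Qed.

Lemma legal_moves_neq_nil P : ~~ terminal P -> legal_moves P <> [::].
Proof.
case: P => c p s; rewrite /terminal /= => /set0Pn[v vW] /(congr1 size) /eqP.
rewrite size_cat !size_map addn_eq0 !size_filter !eqn0Ngt -!has_count.
case/andP=> /hasPn noS /hasPn noF.
have avail w : w \in white c -> available_seed c p w.
  move=> wW; rewrite /available_seed wW /=; apply/existsP => -[u uw].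
  by have /= := noF (u, w); rewrite mem_enum uw => /(_ isT).
have blk w : available_seed c p w -> blocks c p w.
  move=> aw; have := noS w; rewrite mem_enum /legal_seed aw /= => /(_ isT).
  by rewrite negb_imply => /andP[].
have := noS v; rewrite mem_enum /legal_seed avail // => /(_ isT) /negP[].
by apply/implyP => _; apply/forallP => w; apply/implyP/blk.
Qed.

Lemma optimal_neq_nil p U : U <> [::] -> optimal p U <> [::].
Proof.
case: U => // x U _ /eqP; apply/negP; rewrite -has_filter.
have exk : exists k, k \in [seq own_seeds p t | t <- x :: U].
  by exists (own_seeds p x); rewrite mem_head.
case: (ex_minnP exk) => k /mapP[t tU ->] mint.
by apply/hasP; exists t => //; apply/allP => u uU; apply/mint/map_f.
Qed.

Lemma outcomes_neq_nil P : outcomes P <> [::].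
Proof.
have [k] := ubnP #|white (colours P)|; elim: k P => // k IHk P ltPk.
rewrite outcomesE; case: ifPn => // nt; apply: optimal_neq_nil.
have := legal_moves_neq_nil nt; have := @card_white_play P.
case: (legal_moves P) => // mv ms /(_ _ (mem_head _ _)) Emv _ /=.
have: outcomes (play P mv) <> [::] by apply: IHk; rewrite Emv ltnS in ltPk.
by case: (outcomes _).
Qed.

Lemma ex_total_seeds :
  exists k, k \in [seq s.1 + s.2 | s <- outcomes initial].
Proof.
case E: (outcomes initial) => [|s l]; first by case: (outcomes_neq_nil E).
by exists (s.1 + s.2); rewrite mem_head.
Qed.

Definition Zg : nat := ex_minn ex_total_seeds.

End Game.

(* Main.v *)
(* At most one vertex of each part can be forced, namely the last white one, so
   every play uses at least m + n - 2 seeds. Call a position good if some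
   optimal play attains the corresponding lower bound. All outcomes of a non-
   terminal position share one coordinate, that of the player to move; hence, if
   every child is good and no move loses a potential force, a child attaining
   the minimum of the mover also has an outcome attaining both the minimum and
   the bound, and the position is good. This reduces the goodness of positions
   with at least two white vertices in both parts to that of positions with
   exactly one in some part. A position depends only on the number of white
   vertices and the set of colours of each part; with one white vertex in a part
   its outcomes are 2-periodic in the number of white vertices of the other
   part, which leaves finitely many positions to compute. *)
Require Import Defs.
From mathcomp Require Import all_boot.
From mathcomp Require Import zify.

Set Implicit Arguments.
Unset Strict Implicit.
Unset Printing Implicit Defensive.

(** * The game on abstract states *)

(* One part of the bipartition: its number of white vertices, and whether it has
   a blue, respectively a red, vertex. *)
Definition part := (nat * (bool * bool))%type.

Definition present (p : player) (f : bool * bool) : bool :=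
  if p == Alice then f.1 else f.2.

Definition mark (p : player) (f : bool * bool) : bool * bool :=
  if p == Alice then (true, f.2) else (f.1, true).

Definition fill (p : player) (s : part) : part := (s.1.-1, mark p s.2).

(** All of [s] is adjacent to each vertex of [t], so only the last white vertex of [s] can be
    forced. *)
Definition forceable (p : player) (s t : part) : bool :=
  (s.1 == 1) && present p t.2.

Definition seed_open (p : player) (s t : part) : bool :=
  (s.1 != 0) && ~~ forceable p s t.

(* A seed in [s] blocks an opponent's force exactly when it takes the target of
   one. *)
Definition seed_legal (p : player) (s t : part) : bool :=
  seed_open p s t
  && (forceable (opponent p) s t ==>
      (seed_open p t s ==> forceable (opponent p) t s)).

Definition part_moves (p : player) (s t : part) (sc : nat * nat) :
    seq (part * (nat * nat)) :=
  (if seed_legal p s t then [:: (fill p s, add_seed p sc)] else [::])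
  ++ (if forceable p s t then [:: (fill p s, sc)] else [::]).

Definition state := (part * part)%type.

Definition state_moves (p : player) (x : state) (sc : nat * nat) :
    seq (state * (nat * nat)) :=
  [seq ((y.1, x.2), y.2) | y <- part_moves p x.1 x.2 sc]
  ++ [seq ((x.1, y.1), y.2) | y <- part_moves p x.2 x.1 sc].

Fixpoint state_outcomes (k : nat) (p : player) (x : state) (sc : nat * nat) :
    seq (nat * nat) :=
  if k is k'.+1 then
    optimal p (flatten
      [seq state_outcomes k' (opponent p) y.1 y.2 | y <- state_moves p x sc])
  else [:: sc].

(** Bounds the number of forces still to come, since each part admits at most one. *)
Definition unfinished (x : state) : nat := (0 < x.1.1) + (0 < x.2.1).

Definition whites (x : state) : nat := x.1.1 + x.2.1.

(** * Outcome sets, symmetry and translation of scores *)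

Lemma mem_optimal p U t :
  t \in optimal p U =
  (t \in U) && all (fun u => own_seeds p t <= own_seeds p u) U.
Proof. by rewrite mem_filter andbC. Qed.

(** Outcome lists matter only as sets: many vertices of the graph induce the same state move, so
    multiplicities differ. *)
Lemma eq_optimal p U V : U =i V -> optimal p U =i optimal p V.
Proof. by move=> UV t; rewrite !mem_optimal UV (eq_all_r UV). Qed.

Lemma eq_flatten_map (S T : Type) (R : eqType) (f : S -> seq R) (g : T -> seq R)
    (s : seq S) (h : S -> T) :
  (forall x, f x =i g (h x)) ->
  flatten [seq f x | x <- s] =i flatten [seq g y | y <- map h s].
Proof.
by move=> fg t; elim: s => //= x s IHs; rewrite !mem_cat IHs fg.
Qed.

Lemma eq_mem_flatten_map (T R : eqType) (f : T -> seq R) (s t : seq T) :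
  s =i t -> flatten [seq f x | x <- s] =i flatten [seq f x | x <- t].
Proof.
by move=> st r; apply/flatten_mapP/flatten_mapP => -[x xs rx]; exists x => //;
  rewrite ?st // -st.
Qed.

Definition swap_state (x : state) : state := (x.2, x.1).

Lemma state_outcomes_swap k p x sc :
  state_outcomes k p (swap_state x) sc =i state_outcomes k p x sc.
Proof.
elim: k p x sc => //= k IHk p [s t] sc; apply: eq_optimal => u.
pose sw (y : state * (nat * nat)) := (swap_state y.1, y.2).
have moves_sw : state_moves p (s, t) sc =i map sw (state_moves p (t, s) sc).
  by move=> y; rewrite map_cat -!map_comp !mem_cat orbC.
rewrite (eq_mem_flatten_map _ moves_sw); apply: eq_flatten_map => y r.
by rewrite /= IHk.
Qed.

Definition shift (d s : nat * nat) : nat * nat := (d.1 + s.1, d.2 + s.2).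

Lemma shift00 s : shift s (0, 0) = s.
Proof. by case: s => ? ?; rewrite /shift /= !addn0. Qed.

Lemma shiftC d s : shift d s = shift s d.
Proof. by rewrite /shift addnC (addnC d.2). Qed.

Lemma shift_add_seed p d sc :
  add_seed p (shift d sc) = shift d (add_seed p sc).
Proof. by rewrite /add_seed /shift; case: ifP => _ /=; rewrite addnS. Qed.

Lemma optimal_shift p d U :
  optimal p (map (shift d) U) = map (shift d) (optimal p U).
Proof.
rewrite /optimal filter_map; congr map; apply: eq_filter => t /=.
rewrite all_map; apply: eq_all => u /=.
by rewrite /own_seeds; case: ifP => _; rewrite leq_add2l.
Qed.

(** Optimality only compares scores, so the seeds already made act as an additive constant. *)
Lemma state_outcomes_shift k p x d sc :
  state_outcomes k p x (shift d sc) = map (shift d) (state_outcomes k p x sc).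
Proof.
elim: k p x sc => //= k IHk p x sc; rewrite -optimal_shift; congr optimal.
rewrite map_flatten -map_comp.
rewrite /state_moves /part_moves shift_add_seed.
by case: seed_legal; case: forceable; case: seed_legal; case: forceable;
  rewrite //= !IHk.
Qed.

(** * The lower bound on seeds and positions attaining it *)

(** A seed raises the total score by one; a force leaves it unchanged but completes a part. *)
Lemma state_moves_bound p x sc y :
  y \in state_moves p x sc ->
  whites x = (whites y.1).+1 /\
  sc.1 + sc.2 + unfinished y.1 < y.2.1 + y.2.2 + unfinished x.
Proof.
have add_sum : (add_seed p sc).1 + (add_seed p sc).2 = (sc.1 + sc.2).+1.
  by rewrite /add_seed; case: ifP; rewrite /= ?addSn ?addnS.
have pm s t z : z \in part_moves p s t sc ->
   s.1 = z.1.1.+1 /\ sc.1 + sc.2 + (0 < z.1.1) < z.2.1 + z.2.2 + (0 < s.1).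
  rewrite mem_cat => /orP[].
    case: ifP => // /andP[/andP[s0 _] _]; rewrite inE => /eqP->.
    by rewrite /= add_sum; lia.
  case: ifP => // /andP[/eqP s1 _]; rewrite inE => /eqP->.
  by rewrite /= s1; lia.
case: x => -[a f] [b g]; rewrite mem_cat /whites /unfinished.
move=> /orP[] /mapP[[[c h] s] /pm[]];
  by move=> /= E lt -> /=; split; move: lt; lia.
Qed.

Lemma state_outcomes_bound k p x sc t :
  whites x = k -> t \in state_outcomes k p x sc ->
  sc.1 + sc.2 + k <= t.1 + t.2 + unfinished x.
Proof.
elim: k p x sc => [|k IHk] p x sc wx /=.
  by rewrite inE => /eqP->; lia.
rewrite mem_optimal => /andP[/flatten_mapP[y ymv ty] _].
have [wy ub] := state_moves_bound ymv.
rewrite wx in wy; case: wy => wy.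
have := IHk (opponent p) y.1 y.2 (esym wy) ty.
have arith a b d f g : a + d < b + f -> b + k <= g + d -> a + k.+1 <= g + f.
  by lia.
exact: arith ub.
Qed.

(** Equality in [state_outcomes_bound]. *)
Definition efficient (k : nat) (x : state) (sc : nat * nat) (t : nat * nat) :=
  t.1 + t.2 + unfinished x == sc.1 + sc.2 + k.

Definition good (k : nat) (p : player) (x : state) : bool :=
  has (efficient k x (0, 0)) (state_outcomes k p x (0, 0)).

Lemma goodP k p x sc : good k p x ->
  exists2 t, t \in state_outcomes k p x sc & efficient k x sc t.
Proof.
case: sc => s1 s2; case/hasP=> -[t1 t2] tO /eqP /= Et.
exists (shift (s1, s2) (t1, t2)); last by apply/eqP; rewrite /= in Et *; lia.
have := map_f (shift (s1, s2)) tO.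
by rewrite -state_outcomes_shift /shift /= !addn0.
Qed.

Lemma good_step k p a f b g :
  a + b = k ->
  good k.+3 (opponent p) (fill p (a.+2, f), (b.+2, g)) ->
  good k.+3 (opponent p) ((a.+2, f), fill p (b.+2, g)) ->
  good k.+4 p ((a.+2, f), (b.+2, g)).
Proof.
move=> abk good1 good2; rewrite /good.
pose sc := add_seed p (0, 0).
have sc1 : sc.1 + sc.2 = 1 by rewrite /sc /add_seed; case: ifP.
pose x1 : state := (fill p (a.+2, f), (b.+2, g)).
pose x2 : state := ((a.+2, f), fill p (b.+2, g)).
pose O1 := state_outcomes k.+3 (opponent p) x1 sc.
pose O2 := state_outcomes k.+3 (opponent p) x2 sc.
(* No part has a single white vertex, so nothing can be forced or blocked, and the only moves are a
   seed in either part. *)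
have -> : state_outcomes k.+4 p ((a.+2, f), (b.+2, g)) (0, 0) =
          optimal p (O1 ++ O2) by rewrite -[O2]cats0.
(* Outcomes of one child agree in the opponent's coordinate, so the efficient one, having the least
   sum, has the fewest seeds of [p]. *)
have replace x t : x \in [:: x1; x2] ->
    t \in state_outcomes k.+3 (opponent p) x sc ->
  exists2 t', t' \in state_outcomes k.+3 (opponent p) x sc &
    efficient k.+4 ((a.+2, f), (b.+2, g)) (0, 0) t' /\
    own_seeds p t' <= own_seeds p t.
  move=> xx tO; have gx : good k.+3 (opponent p) x.
    by move: xx; rewrite !inE => /orP[] /eqP->.
  have wx : whites x = k.+3 /\ unfinished x = 2.
    by move: xx; rewrite !inE /whites /unfinished => /orP[] /eqP-> /=; lia.
  have [t' t'O /eqP Et'] := goodP sc gx; exists t' => //.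
  have := state_outcomes_bound (proj1 wx) tO.
  move: tO t'O; rewrite !mem_optimal.
  move=> /andP[tU /allP tmin] /andP[t'U /allP t'min].
  have := tmin _ t'U; have := t'min _ tU.
  rewrite /efficient; case: wx Et' => _ ->; rewrite sc1 /unfinished /=.
  rewrite /own_seeds /opponent; case: (p) => /= *; split; lia.
have [t tO] : exists t, t \in optimal p (O1 ++ O2).
  have [t tO _] := goodP sc good1.
  have U0 : O1 ++ O2 <> [::] by move=> E; have := mem_cat t O1 O2; rewrite E tO.
  have := @optimal_neq_nil p _ U0.
  by case: (optimal p _) => // u l _; exists u; rewrite mem_head.
move: (tO); rewrite mem_optimal mem_cat => /andP[tU /allP tmin].
have [t' t'U [eff le]] : exists2 t', t' \in O1 ++ O2 &
    efficient k.+4 ((a.+2, f), (b.+2, g)) (0, 0) t' /\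
    own_seeds p t' <= own_seeds p t.
  case/orP: tU => /replace[|t' t'O H]; rewrite ?inE ?eqxx ?orbT //;
    by exists t'; rewrite // mem_cat t'O ?orbT.
apply/hasP; exists t' => //; rewrite mem_optimal t'U; apply/allP => u /tmin.
exact: leq_trans.
Qed.

(** * Periodicity in the number of white vertices *)

Lemma state_outcomesS k p x sc :
  state_outcomes k.+1 p x sc = optimal p (flatten
    [seq state_outcomes k (opponent p) y.1 y.2 | y <- state_moves p x sc]).
Proof. by []. Qed.

(** With the other part full, every turn but the last is a seed, and the last depends only on [g]
    and on who moves; two more white vertices cost one seed each. *)
Lemma state_outcomes_period0 a p f g sc :
  state_outcomes a.+3 p ((a.+3, f), (0, g)) sc
  =i state_outcomes a.+1 p ((a.+1, f), (0, g)) (shift (1, 1) sc).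
Proof.
have base q fl gl s : state_outcomes 3 q ((3, fl), (0, gl)) s
    =i state_outcomes 1 q ((1, fl), (0, gl)) (shift (1, 1) s).
  (* Both scores become translates by [s], which leaves closed positions to compute. *)
  rewrite [shift (1, 1) s]shiftC -{1}[s]shift00.
  rewrite !state_outcomes_shift; apply: eq_mem_map => t.
  by case: q fl gl => [] [[] []] [[] []].
elim: a p f g sc => [|a IHa] p f g sc; first exact: base.
rewrite !(state_outcomesS, state_outcomesS a.+1); apply: eq_optimal => t.
(* Abstracting the outcome functions keeps [/=] from unfolding them. *)
move: (state_outcomes a.+3) (state_outcomes a.+1) IHa => F F' FF'.
by rewrite /state_moves /part_moves shift_add_seed /= !mem_cat FF'.
Qed.

Lemma state_outcomes_period1 a p f g sc :
  state_outcomes a.+4.+3 p ((a.+4.+2, f), (1, g)) sc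
  =i state_outcomes a.+4.+1 p ((a.+4, f), (1, g)) (shift (1, 1) sc).
Proof.
have base q fl gl s : state_outcomes 7 q ((6, fl), (1, gl)) s
    =i state_outcomes 5 q ((4, fl), (1, gl)) (shift (1, 1) s).
  rewrite [shift (1, 1) s]shiftC -{1}[s]shift00.
  rewrite !state_outcomes_shift; apply: eq_mem_map.
  (* The two lists are compared by mutual inclusion, as sets. *)
  have check :
    all (mem (state_outcomes 7 q (6, fl, (1, gl)) (0, 0)))
        (state_outcomes 5 q (4, fl, (1, gl)) (1, 1)) &&
    all (mem (state_outcomes 5 q (4, fl, (1, gl)) (1, 1)))
        (state_outcomes 7 q (6, fl, (1, gl)) (0, 0)).
    by case: q fl gl => [] [[] []] [[] []]; vm_compute.
  case/andP: check => /allP sub1 /allP sub2 t.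
  by apply/idP/idP => [/sub2|/sub1].
elim: a p f g sc => [|a IHa] p f g sc; first exact: base.
rewrite (state_outcomesS a.+4.+3) (state_outcomesS a.+4.+1).
apply: eq_optimal => t.
have row0 := @state_outcomes_period0 a.+4.
move: (state_outcomes a.+4.+3) (state_outcomes a.+4.+1) IHa row0.
move=> F F' FF' row0.
rewrite /state_moves /part_moves shift_add_seed.
rewrite /seed_legal /seed_open /forceable /fill /=.
(* A move in the large part is covered by [FF']; one in the other part fills it, which is the case
   [row0]. *)
by do 2!case: ifP => _; rewrite /= ?mem_cat ?FF' ?row0.
Qed.

(** * Goodness of positions *)

Lemma good_swap k p x : good k p (swap_state x) = good k p x.
Proof.
rewrite /good (eq_has_r (state_outcomes_swap _ _ _ _)); apply: eq_has => t.
by rewrite /efficient /unfinished /= addnC (addnC (0 < x.2.1)) addnC.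
Qed.

(** Four small values of [a] are computed. Beyond them, two more white vertices add one seed per
    player, exactly as the bound grows. The second hypothesis excludes an opponent with colours in
    both parts facing a mover with none. *)
Lemma good_strip a p f g :
  present (opponent p) g ->
  [|| present p f, present p g | ~~ present (opponent p) f] ->
  good a.+3 p ((a.+2, f), (1, g)).
Proof.
move=> oppg pfg; elim/ltn_ind: a => -[|[|[|[|a]]]] IH;
  try by case: p f g oppg pfg {IH} => [] [[] []] [[] []].
have /(goodP (1, 1))[] : good a.+4.+1 p ((a.+4, f), (1, g)).
  by apply: (IH a.+2); lia.
move=> t tO /eqP /= Et; apply/hasP; exists t.
  by rewrite state_outcomes_period1.
by apply/eqP; rewrite /unfinished /= in Et *; lia.
Qed.

(* Goodness is proved for positions in which the opponent has coloured a vertex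
   or the mover has not; this holds initially and is preserved, and it provides
   the hypotheses of [good_strip]. *)
Lemma good_large a b p f g :
  [|| present (opponent p) f, present (opponent p) g
    | ~~ (present p f || present p g)] ->
  good (a + b).+4 p ((a.+2, f), (b.+2, g)).
Proof.
have [k] := ubnP (a + b); elim: k a b p f g => // k IHk a b p f g ltk H.
have pres_mark q h : present q (mark q h) by case: q.
have opp_mark q h : present (opponent q) (mark q h) = present (opponent q) h.
  by case: q.
have oppK : opponent (opponent p) = p by case: (p).
apply: good_step; rewrite // /fill /=.
  case: a ltk => [|a] ltk.
    (* The part just seeded by [p] has one white vertex left; [good_strip] expects it second. *)
    rewrite -good_swap; apply: good_strip; rewrite oppK ?pres_mark //.
    by rewrite opp_mark; case/or3P: H => [->|->|/norP[_ ->]]; rewrite ?orbT.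
  by apply: IHk; rewrite ?oppK ?pres_mark //; lia.
case: b ltk => [|b] ltk.
  rewrite addn0; apply: good_strip; rewrite oppK ?pres_mark //.
  by rewrite opp_mark; case/or3P: H => [->|->|/norP[-> _]]; rewrite ?orbT.
by rewrite addnS; apply: IHk; rewrite ?oppK ?pres_mark ?orbT //; lia.
Qed.

(** * From the graph to abstract states *)

Section Abstraction.
Variables m n : nat.
Local Notation K := (complete_bipartite m n).
Implicit Types (c : colouring K) (p : player) (u v w : K).

Definition side v : bool := if v is inl _ then true else false.

Definition part_of c (i : bool) : part :=
  (#|[set v in white c | side v == i]|,
   ([exists v, (side v == i) && (c v == Some Alice)],
    [exists v, (side v == i) && (c v == Some Bob)])).

Definition state_of c : state := (part_of c true, part_of c false).

Lemma edge_side u v : edge u v = (side u != side v).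
Proof. by case: u v => ? []. Qed.

Lemma present_part p c i :
  present p (part_of c i).2 = [exists v, (side v == i) && (c v == Some p)].
Proof. by case: p. Qed.

(** The neighbourhood of [u] is the whole opposite part, so a unique white neighbour is the only
    white vertex there. *)
Lemma legal_forceE c p u v :
  legal_force c p u v =
  [&& c u == Some p, side u == ~~ side v, v \in white c
    & (part_of c (side v)).1 == 1].
Proof.
have -> : legal_force c p u v = (c u == Some p) &&
    ([set w in white c | side w == ~~ side u] == [set v]).
  congr (_ && (_ == _)); apply/setP => w; rewrite inE [RHS]inE edge_side.
  by case: (side u) (side w) => [] [].
congr (_ && _); apply/eqP/and3P => [E|[/eqP su vW /cards1P[w Ew]]].
  have /setIdP[vW /eqP sv] : v \in [set w in white c | side w == ~~ side u].
    by rewrite E set11.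
  rewrite vW sv negbK eqxx -sv; split=> //; apply/cards1P; exists v.
  by rewrite -[RHS]E -sv.
have -> : ~~ side u = side v by rewrite su negbK.
have: v \in [set w] by rewrite -Ew inE vW eqxx.
by rewrite inE Ew => /eqP->.
Qed.

Lemma exists_forceE c p v : v \in white c ->
  [exists u, legal_force c p u v] =
  forceable p (part_of c (side v)) (part_of c (~~ side v)).
Proof.
move=> vW; rewrite /forceable present_part.
apply/existsP/andP => [[u]|[w1 /existsP[u /andP[su cu]]]].
  rewrite legal_forceE => /and4P[cu su _ ->]; split=> //.
  by apply/existsP; exists u; rewrite su cu.
by exists u; rewrite legal_forceE cu su vW w1.
Qed.

Lemma white_part_gt0 c v : v \in white c -> (part_of c (side v)).1 != 0.
Proof.
by move=> vW; rewrite -lt0n; apply/card_gt0P; exists v; rewrite inE vW /=.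
Qed.

Lemma white_part c i :
  (part_of c i).1 != 0 -> exists2 v, v \in white c & side v = i.
Proof.
by rewrite -lt0n => /card_gt0P[v]; rewrite inE => /andP[vW /eqP si]; exists v.
Qed.

Lemma part_of_paint c p v i : v \in white c ->
  part_of (paint c p v) i =
  if i == side v then fill p (part_of c i) else part_of c i.
Proof.
move=> vW; have cv : c v = None by move: vW; rewrite inE => /eqP.
have presE q : [exists w, (side w == i) && (paint c p v w == Some q)] =
    [exists w, (side w == i) && (c w == Some q)] || (i == side v) && (p == q).
  apply/existsP/orP => [[w /andP[sw]]|[/existsP[w /andP[sw cw]]|/andP[iv pq]]].
  - rewrite ffunE; case: (w =P v) => [wv|_] cw; last first.
      by left; apply/existsP; exists w; rewrite sw.
    by right; rewrite -wv eq_sym sw; case/eqP: cw => ->/=.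
  - exists w; rewrite sw ffunE; case: (w =P v) => // wv.
    by rewrite wv cv in cw.
  - by exists v; rewrite eq_sym iv ffunE eqxx (eqP pq) eqxx.
rewrite /part_of !presE; case: (i =P side v) => [->|ne] /=; last first.
  rewrite !orbF; congr (_, _); apply: eq_card => w; rewrite white_paint !inE.
  case: (w =P v) => //= ->.
  by case: (side v =P i) => [/esym/ne|]; rewrite ?andbF.
congr (_, _); last by case: (p); rewrite /mark /= !(orbT, orbF).
rewrite /= (cardsD1 v [set w in white c | _]) inE vW eqxx /=.
by apply: eq_card => w; rewrite white_paint !inE andbA.
Qed.

Lemma blocksE c p v : v \in white c ->
  blocks c p v =
  forceable (opponent p) (part_of c (side v)) (part_of c (~~ side v)).
Proof.
move=> vW; rewrite -exists_forceE //; apply/existsP/existsP => -[u].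
  case/existsP=> w /andP[uw].
  move: (uw); rewrite legal_forceE => /and4P[cu su wW w1].
  have [<-|wv] := eqVneq w v; first by exists u.
  (* The target [w] is the only white vertex of its part, so another white [v] lies in the other
     part and seeding it leaves the force legal. *)
  have swv : side w != side v.
    apply: contraNneq wv => swv; rewrite swv /= in w1; case/cards1P: w1 => x Ex.
    have: v \in [set x] by rewrite -Ex inE vW eqxx.
    have: w \in [set x] by rewrite -Ex inE wW swv eqxx.
    by rewrite !inE => /eqP-> /eqP->.
  rewrite legal_forceE su part_of_paint // (negPf swv) w1 white_paint.
  rewrite inE inE wv wW.
  have [Eu|uv] := eqVneq u v; first by move: vW; rewrite inE -Eu (eqP cu).
  by rewrite ffunE (negPf uv) cu.
move=> uv; exists u; apply/existsP; exists v.
rewrite uv legal_forceE white_paint.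
by rewrite !inE eqxx !andbF.
Qed.

Lemma available_seedE c p v :
  available_seed c p v =
  (v \in white c) && seed_open p (part_of c (side v)) (part_of c (~~ side v)).
Proof.
rewrite /available_seed /seed_open; case vW: (v \in white c) => //=.
by rewrite exists_forceE ?white_part_gt0.
Qed.

(** Seeds in one part all block or all do not, so the clause on every available seed need only be
    tested on the opposite part. *)
Lemma legal_seedE c p v :
  legal_seed c p v =
  (v \in white c) && seed_legal p (part_of c (side v)) (part_of c (~~ side v)).
Proof.
rewrite /legal_seed available_seedE /seed_legal.
case vW: (v \in white c) => //=; rewrite blocksE //.
case ov: seed_open => //=; case bv: forceable => //=.
apply/forallP/implyP => [all_blk /andP[w0 nf]|blk w].
  have [w wW sw] := white_part w0.
  have := all_blk w; rewrite available_seedE blocksE // wW sw negbK.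
  by rewrite /seed_open w0 nf.
apply/implyP; rewrite available_seedE => /andP[wW ow]; rewrite blocksE //.
have [E|E] := eqVneq (side w) (side v); first by rewrite E.
have {}E : side w = ~~ side v by case: (side w) (side v) E => [] [].
by move: ow; rewrite E negbK; apply: blk.
Qed.

Lemma mem_state_moves c p sc y :
  reflect
    (exists i, exists2 z,
       z \in part_moves p (part_of c i) (part_of c (~~ i)) sc
     & y = ((if i then z.1 else part_of c true,
             if i then part_of c false else z.1), z.2))
    (y \in state_moves p (state_of c) sc).
Proof.
rewrite mem_cat; apply: (iffP orP) => [[]/mapP[z zm ->]|[[] [z zm ->]]].
- by exists true, z.
- by exists false, z.
- by left; apply/mapP; exists z.
- by right; apply/mapP; exists z.
Qed.

Lemma state_of_paint c p v : v \in white c ->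
  state_of (paint c p v) =
  (if side v then fill p (part_of c (side v)) else part_of c true,
   if side v then part_of c false else fill p (part_of c (side v))).
Proof. by move=> vW; rewrite /state_of !part_of_paint //; case: (side v). Qed.

Definition state_score (P : position K) := (state_of (colours P), score P).

Lemma legal_moves_state c p sc :
  [seq state_score (play (Position c p sc) mv)
     | mv <- legal_moves (Position c p sc)]
  =i state_moves p (state_of c) sc.
Proof.
move=> y; apply/mapP/mem_state_moves => [[mv]|[i [z]]].
  rewrite mem_cat => /orP[] /mapP[].
    move=> v; rewrite mem_filter legal_seedE => /andP[/andP[vW lv] _] -> ->.
    exists (side v), (fill p (part_of c (side v)), add_seed p sc).
      by rewrite mem_cat lv mem_head.
    by rewrite /state_score /= state_of_paint.
  move=> [u v]; rewrite mem_filter /= => /andP[uv _] -> ->.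
  have vW := legal_force_white uv.
  exists (side v), (fill p (part_of c (side v)), sc).
    rewrite mem_cat -exists_forceE //.
    by rewrite (introT existsP) ?mem_head ?orbT //; exists u.
  by rewrite /state_score /= state_of_paint.
rewrite mem_cat => /orP[]; case: ifP => // H; rewrite inE => /eqP-> ->.
  have /andP[/andP[i0 _] _] := H; have [v vW sv] := white_part i0.
  rewrite -sv in H *; exists (Seed v);
    last by rewrite /state_score /= state_of_paint.
  rewrite mem_cat; apply/orP; left; apply/mapP; exists v => //.
  by rewrite mem_filter mem_enum legal_seedE vW H.
have i0 : (part_of c i).1 != 0 by case/andP: H => /eqP->.
have [v vW sv] := white_part i0; rewrite -sv in H *.
have := H; rewrite -exists_forceE // => /existsP[u uv].
exists (Force u v); last by rewrite /state_score /= state_of_paint.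
rewrite mem_cat; apply/orP; right; apply/mapP; exists (u, v) => //.
by rewrite mem_filter mem_enum uv.
Qed.

Lemma outcomes_rec_state k c p sc :
  outcomes_rec k (Position c p sc) =i state_outcomes k p (state_of c) sc.
Proof.
elim: k c p sc => //= k IHk c p sc; apply: eq_optimal => t.
rewrite -(eq_mem_flatten_map _ (legal_moves_state c p sc)).
by apply: eq_flatten_map => -[v|[u v]] r; rewrite -IHk.
Qed.

Lemma outcomes_initial :
  outcomes (initial K) =i
  state_outcomes (m + n) Alice ((m, (false, false)), (n, (false, false)))
    (0, 0).
Proof.
have all_white : white [ffun=> None] = [set: K].
  by apply/setP => v; rewrite !inE ffunE eqxx.
have absent i p :
    [exists v : K, (side v == i) && ([ffun=> None] v == Some p)] = false.
  by apply/existsP => -[v]; rewrite ffunE andbF.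
have stE : state_of [ffun=> None] = ((m, (false, false)), (n, (false, false))).
  rewrite /state_of /part_of !absent all_white; congr (_, _, (_, _)).
    have -> : [set v in [set: K] | side v == true] =
              [set (inl i : K) | i : 'I_m].
      apply/setP => -[i|i]; rewrite !inE /=; first by rewrite imset_f.
      by apply/esym/imsetP => -[].
    by rewrite card_imset ?card_ord //; apply: inl_inj.
  have -> : [set v in [set: K] | side v == false] =
            [set (inr i : K) | i : 'I_n].
    apply/setP => -[i|i]; rewrite !inE /=; last by rewrite imset_f.
    by apply/esym/imsetP => -[].
  by rewrite card_imset ?card_ord //; apply: inr_inj.
move=> t; rewrite /outcomes outcomes_rec_state /= all_white stE.
by rewrite cardsT card_sum !card_ord.
Qed.

End Abstraction.

(** * The game zero forcing number *)

Theorem theorem19 (m n : nat) (hm : 2 <= m) (hn : 2 <= n) :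
  Zg (complete_bipartite m n) = m + n - 2.
Proof.
pose x : state := ((m, (false, false)), (n, (false, false))).
have gx : good (m + n) Alice x.
  rewrite {}/x; case: m n hm hn => [|[|a]] // [|[|b]] // _ _.
  by rewrite !addSn !addnS; apply: good_large.
have [t tO /eqP] := goodP (0, 0) gx.
(* The minimiser [s] obeys the lower bound, and its sum is at most that of the efficient outcome
   [t], which attains the bound. *)
rewrite /Zg; case: ex_minnP => k /mapP[s sO ->] kmin.
have := @state_outcomes_bound (m + n) Alice x (0, 0) s erefl.
rewrite -outcomes_initial => /(_ sO).
have: s.1 + s.2 <= t.1 + t.2.
  by apply: kmin; apply/mapP; exists t; rewrite // outcomes_initial.
have -> : unfinished x = 2 by rewrite /unfinished /= (ltnW hm) (ltnW hn).
move: (s.1 + s.2) (t.1 + t.2) => S T /=; lia.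
Qed.
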